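(* Let $H=\{H_\alpha\}_{\alpha\in\pi}$ be a finite dimensional Hopf $\pi$-coalgebra. Let $\lambda=(\lambda_\alpha)_{\alpha\in\pi}$ be a right $\pi$-integral for $H$, $g=(g_\alpha)_{\alpha\in\pi}$ the distinguished $\pi$-grouplike element of $H$, and $\nu$ the distinguished grouplike element of $H_1^*$. Then, for any $\alpha\in\pi$ and $x,y\in H_\alpha$: (a) $\lambda_\alpha(xy)=\lambda_\alpha(S_{\alpha^{-1}}S_\alpha(y\leftharpoonup\nu)\,x)$; (b) $\lambda_\alpha(xy)=\lambda_\alpha(y\,S_{\alpha^{-1}}S_\alpha(\nu^{-1}\rightharpoonup g_\alpha^{-1}xg_\alpha))$; (c) $\lambda_{\alpha^{-1}}(S_\alpha(x))=\lambda_\alpha(g_\alpha x)$.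
   Context: Throughout, $\pi$ is a discrete group with neutral element $1$, $\Bbbk$ is a field, $\otimes=\otimes_\Bbbk$, and algebras are associative and unital over $\Bbbk$ (the zero algebra is allowed). A $\pi$-coalgebra is a family $C=\{C_\alpha\}_{\alpha\in\pi}$ of $\Bbbk$-spaces with $\Bbbk$-linear maps $\Delta_{\alpha,\beta}:C_{\alpha\beta}\to C_\alpha\otimes C_\beta$ and $\epsilon:C_1\to\Bbbk$ such that $(\Delta_{\alpha,\beta}\otimes\mathrm{id}_{C_\gamma})\Delta_{\alpha\beta,\gamma}=(\mathrm{id}_{C_\alpha}\otimes\Delta_{\beta,\gamma})\Delta_{\alpha,\beta\gamma}$ and $(\mathrm{id}_{C_\alpha}\otimes\epsilon)\Delta_{\alpha,1}=\mathrm{id}_{C_\alpha}=(\epsilon\otimes\mathrm{id}_{C_\alpha})\Delta_{1,\alpha}$ for all $\alpha,\beta,\gamma\in\pi$. A Hopf $\pi$-coalgebra is a $\pi$-coalgebra $H=(\{H_\alpha\},\Delta,\epsilon)$ with $\Bbbk$-linear maps $S_\alpha:H_\alpha\to H_{\alpha^{-1}}$ (the antipode) such that each $H_\alpha$ is an algebra with multiplication $m_\alpha$ and unit $1_\alpha$, the maps $\epsilon$ and all $\Delta_{\alpha,\beta}$ are algebra homomorphisms, and $m_\alpha(S_{\alpha^{-1}}\otimes\mathrm{id}_{H_\alpha})\Delta_{\alpha^{-1},\alpha}=\epsilon 1_\alpha=m_\alpha(\mathrm{id}_{H_\alpha}\otimes S_{\alpha^{-1}})\Delta_{\alpha,\alpha^{-1}}$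 for all $\alpha$. $H_1$ is then an ordinary Hopf algebra. $H$ is finite dimensional if every $H_\alpha$ is finite dimensional over $\Bbbk$. A right $\pi$-integral for $H$ is a family $\lambda=(\lambda_\alpha)_{\alpha\in\pi}\in\prod_{\alpha}H_\alpha^*$ with $(\lambda_\alpha\otimes\mathrm{id}_{H_\beta})\Delta_{\alpha,\beta}=\lambda_{\alpha\beta}\,1_\beta$ for all $\alpha,\beta\in\pi$. A $\pi$-grouplike element of $H$ is a family $g=(g_\alpha)_{\alpha\in\pi}\in\prod_\alpha H_\alpha$ with $\Delta_{\alpha,\beta}(g_{\alpha\beta})=g_\alpha\otimes g_\beta$ for all $\alpha,\beta$ and $\epsilon(g_1)=1$; each $g_\alpha$ is then invertible with inverse $S_{\alpha^{-1}}(g_{\alpha^{-1}})$. The distinguished $\pi$-grouplike element of a finite dimensional $H$ is the unique $\pi$-grouplike element $g$ such that $(\mathrm{id}_{H_\alpha}\otimes\lambda_\beta)\Delta_{\alpha,\beta}=\lambda_{\alpha\beta}\,g_\alpha$ for every right $\pi$-integral $\lambda$ and all $\alpha,\beta\in\pi$. A left integral for $H_1$ is $\Lambda\in H_1$ with $x\Lambda=\epsilon(x)\Lambda$ for all $x\in H_1$. The distinguished grouplike element of $H_1^*$ is the unique algebra morphism $\nu:H_1\to\Bbbk$ such that $\Lambda x=\nu(x)\Lambda$ for every left integral $\Lambda$ for $H_1$ and all $x\in H_1$; $\nu^{-1}$ is its inverse in the convolution algebra $H_1^*$. For $f\in H_1^*$ and $a\in H_\alpha$: $f\rightharpoonup a=(\mathrm{id}_{H_\alpha}\otimes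 f)\Delta_{\alpha,1}(a)$ and $a\leftharpoonup f=(f\otimes\mathrm{id}_{H_\alpha})\Delta_{1,\alpha}(a)$. *)

(* Defs.v *)
From HB Require Import structures.
From mathcomp Require Import all_boot all_algebra.

Set Implicit Arguments.
Unset Strict Implicit.
Unset Printing Implicit Defensive.

Import GRing.Theory.
Local Open Scope ring_scope.

(* Finite dimensional associative unital algebras over a field. The library's
   falgType and algType exclude the zero algebra (they extend nzRingType);
   here 1 = 0 is allowed, so we only get a pzRingType. *)
HB.mixin Record Vector_isFdAlgebra (k : fieldType) A of Vector k A := {
  fda_mul : A -> A -> A;
  fda_one : A;
  fda_mulA : associative fda_mul;
  fda_mul1l : left_id fda_one fda_mul;
  fda_mul1r : right_id fda_one fda_mul;
  fda_mulDl : left_distributive fda_mul +%R;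
  fda_mulDr : right_distributive fda_mul +%R;
  fda_mulZl : forall (c : k) (x y : A),
    c *: fda_mul x y = fda_mul (c *: x) y;
  fda_mulZr : forall (c : k) (x y : A),
    c *: fda_mul x y = fda_mul x (c *: y)
}.

#[short(type="fdAlgType")]
HB.structure Definition FdAlg (k : fieldType) :=
  {A of Vector k A & Vector_isFdAlgebra k A}.

HB.instance Definition _ (k : fieldType) (A : fdAlgType k) :=
  GRing.Zmodule_isPzRing.Build (FdAlg.sort A)
    fda_mulA fda_mul1l fda_mul1r fda_mulDl fda_mulDr.

Lemma fdalg_scalerAl (k : fieldType) (A : fdAlgType k) (c : k) (x y : A) :
  c *: (x * y) = (c *: x) * y.
Proof. exact: fda_mulZl. Qed.

Lemma fdalg_scalerAr (k : fieldType) (A : fdAlgType k) (c : k) (x y : A) :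
  c *: (x * y) = x * (c *: y).
Proof. exact: fda_mulZr. Qed.

(* The tensor product of finite dimensional spaces U and V, as the space of
   coordinate matrices with respect to the basis e_i (x) f_j, where e and f are
   the library's chosen bases of U and V. Lemmas tlift_tens and tensor_ext give
   its universal property, so nothing depends on the choice of bases. *)
Section Tensor.
Variable k : fieldType.
Implicit Types U V W : vectType k.

Definition tensor U V : vectType k := 'M[k]_(\dim {:U}, \dim {:V}).

Definition tens U V (u : U) (v : V) : tensor U V :=
  \matrix_(i, j) (coord (vbasis {:U}) i u * coord (vbasis {:V}) j v).

(* The linear map U (x) V -> W induced by a bilinear b : U -> V -> W. *)
Definition tlift U V W (b : U -> V -> W) (t : tensor U V) : W :=
  \sum_i \sum_j (t : 'M[k]_(_, _)) i j *: b (vbasis {:U})`_i (vbasis {:V})`_j.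

Lemma tens_linearl U V (v : V) : linear (fun u : U => tens u v).
Proof.
by move=> c u u'; apply/matrixP=> i j; rewrite !mxE linearP mulrDl -mulrA.
Qed.

Lemma tens_linearr U V (u : U) : linear (fun v : V => tens u v).
Proof.
move=> c v v'; apply/matrixP=> i j.
by rewrite !mxE linearP mulrDr; congr (_ + _); exact: mulrCA.
Qed.

Lemma tlift_linear U V W (b : U -> V -> W) : linear (tlift b).
Proof.
move=> c s t; rewrite /tlift scaler_sumr -big_split; apply: eq_bigr => i _ /=.
rewrite scaler_sumr -big_split; apply: eq_bigr => j _ /=.
by rewrite !mxE scalerDl scalerA.
Qed.

HB.instance Definition _ U V W (b : U -> V -> W) :=
  GRing.isLinear.Build k (tensor U V) W _ (tlift b) (tlift_linear b).

Lemma tlift_tens U V W (b : U -> V -> W) :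
    (forall v, linear (fun u => b u v)) -> (forall u, linear (b u)) ->
  forall u v, tlift b (tens u v) = b u v.
Proof.
move=> bl br u v.
pose bL v : {linear U -> W} :=
  HB.pack (b^~ v) (GRing.isLinear.Build _ _ _ _ _ (bl v)).
pose bR u : {linear V -> W} :=
  HB.pack (b u) (GRing.isLinear.Build _ _ _ _ _ (br u)).
rewrite [in RHS](coord_vbasis (memvf u)) -[RHS]/(bL v _) linear_sum.
apply: eq_bigr => i _; rewrite linearZ /=.
rewrite [in RHS](coord_vbasis (memvf v)) -[b _ (\sum_j _)]/(bR _ _) linear_sum.
rewrite scaler_sumr; apply: eq_bigr => j _.
by rewrite linearZ /= mxE scalerA.
Qed.

Lemma tensor_ext U V W (f h : {linear tensor U V -> W}) :
  (forall u v, f (tens u v) = h (tens u v)) -> f =1 h.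
Proof.
move=> fh t.
suff -> : t = \sum_i \sum_j (t : 'M_(_, _)) i j *:
    tens (vbasis {:U})`_i (vbasis {:V})`_j.
  rewrite !linear_sum; apply: eq_bigr => i _; rewrite !linear_sum.
  by apply: eq_bigr => j _; rewrite !linearZ /= fh.
apply/matrixP=> i j; rewrite summxE (bigD1 i) //= summxE (bigD1 j) //=.
have coordE (Z : vectType k) (a b : 'I_(\dim {:Z})) :
    coord (vbasis {:Z}) a (vbasis {:Z})`_b = (a == b)%:R.
  by rewrite eq_sym; apply: coord_free; apply: basis_free (vbasisP _).
rewrite !mxE !coordE !eqxx !mulr1 big1 ?addr0 => [|l nlj]; last first.
  by rewrite !mxE !coordE (eq_sym j) (negPf nlj) !mulr0.
rewrite big1 ?addr0 // => l nli; rewrite summxE big1 // => m _.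
by rewrite !mxE !coordE (eq_sym i) (negPf nli) mul0r mulr0.
Qed.

Definition tmap U V U' V' (f : U -> U') (h : V -> V') :
    tensor U V -> tensor U' V' :=
  tlift (fun u v => tens (f u) (h v)).

Definition tassoc U V W : tensor (tensor U V) W -> tensor U (tensor V W) :=
  tlift (fun t w => tlift (fun u v => tens u (tens v w)) t).

(* f (x) id and id (x) f for a linear form f, with k (x) V = V = V (x) k. *)
Definition tforml U V (f : U -> k) : tensor U V -> V :=
  tlift (fun u v => f u *: v).

Definition tformr U V (f : V -> k) : tensor U V -> U :=
  tlift (fun u v => f v *: u).

Definition talg_mul (A : fdAlgType k) : tensor A A -> A :=
  tlift (fun x y : A => x * y).

Definition tensor_mul (A B : fdAlgType k) (s t : tensor A B) : tensor A B :=
  tlift (fun (a : A) (b : B) =>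
    tlift (fun (a' : A) (b' : B) => tens (a * a') (b * b')) t) s.

Definition tensor_one (A B : fdAlgType k) : tensor A B :=
  tens (1 : A) (1 : B).

Lemma tmap_tens U V U' V' (f : U -> U') (h : V -> V') u v :
  linear f -> linear h -> tmap f h (tens u v) = tens (f u) (h v).
Proof.
move=> fl hl.
apply: (tlift_tens (b := fun u v => tens (f u) (h v))) => [w|w] c x y.
  by rewrite fl tens_linearl.
by rewrite hl tens_linearr.
Qed.

Lemma talg_mul_tens (A : fdAlgType k) (x y : A) : talg_mul (tens x y) = x * y.
Proof.
apply: (tlift_tens (b := fun x y : A => x * y)) => z c u v.
  by rewrite mulrDl fdalg_scalerAl.
by rewrite mulrDr fdalg_scalerAr.
Qed.

End Tensor.

(* Components whose indices are only provably equal (such as those at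
   a * (b * c) and a * b * c, a * 1 and a, a^-1^-1 and a) are identified by
   transport along the group law; equality proofs in pi are unique since pi has
   decidable equality. *)
Definition tr (k : fieldType) (pi : groupType) (C : pi -> vectType k)
    (a b : pi) (e : a = b) (x : C a) : C b :=
  ecast c (C c) e x.
Arguments tr {k pi} C {a b} e x.

Lemma tr_fam (k : fieldType) (pi : groupType) (C : pi -> vectType k)
    (g : forall a, C a) (a b : pi) (e : a = b) :
  tr C e (g a) = g b.
Proof. by case: b / e. Qed.

Lemma tr_linear (k : fieldType) (pi : groupType) (C : pi -> vectType k)
    (a b : pi) (e : a = b) : linear (tr C e).
Proof. by case: b / e => c x y. Qed.

(* Values of linear forms live in k^o; they are cast back to k below when used
   as scalars, so that *: is the action of k. *)
Record piCoalgebra (k : fieldType) (pi : groupType) (C : pi -> vectType k) :=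
  PiCoalgebra {
    pic_comul : forall a b : pi, 'Hom(C (a * b)%g, tensor (C a) (C b));
    pic_counit : 'Hom(C 1%g, k^o);
    pic_comulA : forall (a b c : pi) (x : C (a * b * c)%g),
      tassoc (tmap (pic_comul a b) idfun (pic_comul (a * b)%g c x)) =
      tmap idfun (pic_comul b c)
        (pic_comul a (b * c)%g (tr C (esym (mulgA a b c)) x));
    pic_counitr : forall (a : pi) (x : C a),
      tformr pic_counit (pic_comul a 1%g (tr C (esym (mulg1 a)) x)) = x;
    pic_counitl : forall (a : pi) (x : C a),
      tforml pic_counit (pic_comul 1%g a (tr C (esym (mul1g a)) x)) = x
  }.

Record hopfPiCoalgebra (k : fieldType) (pi : groupType) := HopfPiCoalgebra {
  hpc_alg :> pi -> fdAlgType k;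
  hpc_coalg : piCoalgebra (fun a => hpc_alg a : vectType k);
  antipode : forall a : pi, 'Hom(hpc_alg a, hpc_alg a^-1%g);
  hpc_comulM : forall (a b : pi) (x y : hpc_alg (a * b)%g),
    pic_comul hpc_coalg a b (x * y) =
    tensor_mul (pic_comul hpc_coalg a b x) (pic_comul hpc_coalg a b y);
  hpc_comul1 : forall a b : pi,
    pic_comul hpc_coalg a b (1 : hpc_alg (a * b)%g) =
    tensor_one (hpc_alg a) (hpc_alg b);
  hpc_counitM : forall x y : hpc_alg 1%g,
    pic_counit hpc_coalg (x * y) =
    pic_counit hpc_coalg x * pic_counit hpc_coalg y;
  hpc_counit1 : pic_counit hpc_coalg (1 : hpc_alg 1%g) = 1;
  hpc_antipodel : forall (a : pi) (x : hpc_alg 1%g),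
    talg_mul (tmap (fun z => tr hpc_alg (invgK a) (antipode a^-1%g z)) idfun
      (pic_comul hpc_coalg a^-1%g a (tr hpc_alg (esym (mulVg a)) x))) =
    (pic_counit hpc_coalg x : k) *: (1 : hpc_alg a);
  hpc_antipoder : forall (a : pi) (x : hpc_alg 1%g),
    talg_mul (tmap idfun (fun z => tr hpc_alg (invgK a) (antipode a^-1%g z))
      (pic_comul hpc_coalg a a^-1%g (tr hpc_alg (esym (mulgV a)) x))) =
    (pic_counit hpc_coalg x : k) *: (1 : hpc_alg a)
}.

Section HopfTheory.
Variables (k : fieldType) (pi : groupType) (H : hopfPiCoalgebra k pi).

Definition comul (a b : pi) : 'Hom(H (a * b)%g, tensor (H a) (H b)) :=
  pic_comul (hpc_coalg H) a b.

Definition counit : 'Hom(H 1%g, k^o) := pic_counit (hpc_coalg H).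

(* S_{a^-1} : H_{a^-1} -> H_a. *)
Definition antipodeV (a : pi) (x : H a^-1%g) : H a :=
  tr (hpc_alg H) (invgK a) (antipode H a^-1%g x).

Definition right_pi_integral (lam : forall a : pi, 'Hom(H a, k^o)) : Prop :=
  forall (a b : pi) (x : H (a * b)%g),
    tforml (lam a) (comul a b x) = (lam (a * b)%g x : k) *: (1 : H b).

Definition pi_grouplike (g : forall a : pi, H a) : Prop :=
  (forall a b : pi, comul a b (g (a * b)%g) = tens (g a) (g b)) /\
  counit (g 1%g) = 1.

Definition distinguished_pi_grouplike (g : forall a : pi, H a) : Prop :=
  pi_grouplike g /\
  forall lam : (forall a : pi, 'Hom(H a, k^o)), right_pi_integral lam ->
  forall (a b : pi) (x : H (a * b)%g),
    tformr (lam b) (comul a b x) = (lam (a * b)%g x : k) *: g a.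

Definition left_integral (L : H 1%g) : Prop :=
  forall x : H 1%g, x * L = (counit x : k) *: L.

Definition algebra_form (nu : 'Hom(H 1%g, k^o)) : Prop :=
  (forall x y : H 1%g, nu (x * y) = nu x * nu y) /\ nu (1 : H 1%g) = 1.

Definition distinguished_grouplike_dual (nu : 'Hom(H 1%g, k^o)) : Prop :=
  algebra_form nu /\
  forall L : H 1%g, left_integral L ->
  forall x : H 1%g, L * x = (nu x : k) *: L.

Definition convolution (f h : 'Hom(H 1%g, k^o)) (x : H 1%g) : k :=
  tlift (fun u v => f u * h v : k^o)
    (comul 1%g 1%g (tr (hpc_alg H) (esym (mulg1 1%g)) x)).

Definition convolution_inverse (f h : 'Hom(H 1%g, k^o)) : Prop :=
  convolution f h =1 counit /\ convolution h f =1 counit.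

Definition mul_inverse (a : pi) (x y : H a) : Prop := x * y = 1 /\ y * x = 1.

(* Harpoon actions of H_1^* on H_a: f acts from the left in hitl f x, and from
   the right in hitr x f. *)
Definition hitl (a : pi) (f : 'Hom(H 1%g, k^o)) (x : H a) : H a :=
  tformr f (comul a 1%g (tr (hpc_alg H) (esym (mulg1 a)) x)).

Definition hitr (a : pi) (x : H a) (f : 'Hom(H 1%g, k^o)) : H a :=
  tforml f (comul 1%g a (tr (hpc_alg H) (esym (mul1g a)) x)).

Lemma antipodeV_linear a : linear (@antipodeV a).
Proof. by move=> c x y; rewrite /antipodeV linearP tr_linear. Qed.

(* Inverses of grouplike elements and of algebra forms always exist, so
   quantifying over all inverses in this sense is the same as using the
   inverse. *)
Lemma pi_grouplike_inverse (g : forall a, H a) : pi_grouplike g ->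
  forall a, mul_inverse (g a) (antipodeV (g a^-1%g)).
Proof.
case=> gD g1 a; split.
- have := hpc_antipoder a (g 1%g).
  rewrite tr_fam (gD a a^-1%g) tmap_tens //; last exact: antipodeV_linear.
  by rewrite talg_mul_tens -[pic_counit _ _]/(counit _) g1 scale1r.
have := hpc_antipodel a (g 1%g).
rewrite tr_fam (gD a^-1%g a) tmap_tens //; last exact: antipodeV_linear.
by rewrite talg_mul_tens -[pic_counit _ _]/(counit _) g1 scale1r.
Qed.

Lemma convolution_invertible (nu : 'Hom(H 1%g, k^o)) : algebra_form nu ->
  exists nuV, convolution_inverse nu nuV.
Proof.
case=> nuM nu1.
pose SV b (e : 1^-1%g = b) (x : H b) : H 1%g :=
  antipodeV (tr (hpc_alg H) (esym e) x).
have antil b e e' (x : H 1%g) : talg_mul (tmap (SV b e) idfun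
    (comul b 1%g (tr (hpc_alg H) e' x))) = (counit x : k) *: (1 : H 1%g).
  case: b / e e' => e'; rewrite -(hpc_antipodel 1%g x).
  by rewrite (eq_irrelevance e' (esym (mulVg 1%g))).
have antir b e e' (x : H 1%g) : talg_mul (tmap idfun (SV b e)
    (comul 1%g b (tr (hpc_alg H) e' x))) = (counit x : k) *: (1 : H 1%g).
  case: b / e e' => e'; rewrite -(hpc_antipoder 1%g x).
  by rewrite (eq_irrelevance e' (esym (mulgV 1%g))).
pose S1 := SV 1%g (@invg1 pi).
have S1l : linear S1 by move=> c x y; rewrite /S1/SV tr_linear antipodeV_linear.
pose S1L : {linear H 1%g -> H 1%g} :=
  HB.pack S1 (GRing.isLinear.Build _ _ _ _ _ S1l).
have S1E x : linfun S1L x = S1 x by rewrite lfunE.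
have nu_mul (p q : {linear H 1%g -> H 1%g}) t :
    tlift (fun u v => (nu \o linfun p)%VF u * (nu \o linfun q)%VF v : k^o) t =
    nu (talg_mul (tmap p q t)).
  pose F : {linear tensor (H 1%g) (H 1%g) -> k^o} :=
    tlift (fun u v => (nu \o linfun p)%VF u * (nu \o linfun q)%VF v : k^o).
  pose G : {linear tensor (H 1%g) (H 1%g) -> k^o} :=
    nu \o (tlift (fun x y : H 1%g => x * y) \o
           tlift (fun u v => tens (p u) (q v))).
  apply: (@tensor_ext _ _ _ _ F G) => u v.
  rewrite [LHS]tlift_tens.
  - have -> : G (tens u v) = nu (talg_mul (tmap p q (tens u v))) by [].
    rewrite tmap_tens; [|exact: linearP..].
    by rewrite talg_mul_tens nuM !lfunE /= !lfunE.
  - by move=> w c y z; rewrite linearP mulrDl -scalerAl.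
  by move=> w c y z; rewrite linearP mulrDr -scalerAr.
have nuE (f : {linear H 1%g -> H 1%g}) y : (nu \o linfun f)%VF y = nu (f y).
  by rewrite lfunE /= lfunE.
have nu1E : nu = (nu \o linfun (idfun : H 1%g -> H 1%g))%VF.
  by apply/lfunP=> y; rewrite nuE.
exists (nu \o linfun S1L)%VF; split=> x; rewrite /convolution.
- have := congr1 nu (antir _ (@invg1 pi) (esym (mulg1 1%g)) x).
  rewrite linearZ /= nu1 [_ *: _]mulr1 => <-.
  by have := nu_mul idfun S1L; rewrite -nu1E; apply.
have := congr1 nu (antil _ (@invg1 pi) (esym (mulg1 1%g)) x).
rewrite linearZ /= nu1 [_ *: _]mulr1 => <-.
by have := nu_mul S1L idfun; rewrite -nu1E; apply.
Qed.

End HopfTheory.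

Arguments comul {k pi} H a b.
Arguments counit {k pi} H.
Arguments antipodeV {k pi H a} x.
Arguments right_pi_integral {k pi} H lam.
Arguments distinguished_pi_grouplike {k pi} H g.
Arguments distinguished_grouplike_dual {k pi} H nu.

(* Main.v *)
(* If lam is nonzero, then lam_1 is nondegenerate on H_1, so some left integral L
   of H_1 has lam_1 (L) = 1. Writing L_(1) (x) L_(2) for its coproduct in
   H_a (x) H_b, b = a^-1, the relations
     L_(1) (x) x L_(2) = S(x) L_(1) (x) L_(2),
     L_(1) y (x) L_(2) = L_(1) (x) L_(2) S(y <- nu)
   show that L_(1) and S(L_(2)) are dual bases for the form lam_a (x y). Part (a)
   follows by expanding x in these bases and moving y through the second
   relation. Since g_a = lam_b (L_(2)) L_(1), the second relation also gives
   lam_a (g z) = lam_b (S(z <- nu)), hence (c), because z |-> lam_a (g z) is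
   invariant under z |-> z <- nu. Finally (b) is obtained from (a) and (c) as
     lam (g x y) = lam (S(y) S(x)) = lam (S^2(S(x) <- nu) S(y))
                 = lam (S(y S^2(nu^-1 -> x))) = lam (g y S^2(nu^-1 -> x)),
   with x replaced by g^-1 x g and y by g^-1 y. *)

From HB Require Import structures.
From mathcomp Require Import all_boot all_algebra.
Require Import Defs.

Set Implicit Arguments.
Unset Strict Implicit.
Unset Printing Implicit Defensive.

Import GRing.Theory.
Local Open Scope ring_scope.

(** * Calculus of linear maps and of maps induced on tensor products *)

Section Linear.
Variables (k : fieldType) (U V W : vectType k).

Lemma linear_id : linear (fun x : U => x).
Proof. by []. Qed.

Lemma scale_linear (f : U -> V) (c : k) x : linear f -> f (c *: x) = c *: f x.
Proof.
move=> fl.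
pose fL : {linear U -> V} := HB.pack f (GRing.isLinear.Build _ _ _ _ _ fl).
by rewrite -[LHS]/(fL _) linearZ.
Qed.

Lemma linear_comp (f : V -> W) (g : U -> V) :
  linear f -> linear g -> linear (fun x => f (g x)).
Proof. by move=> fl gl c x y; rewrite gl fl. Qed.

Lemma linear_lfun (h : 'Hom(V, W)) (f : U -> V) :
  linear f -> linear (fun x => h (f x)).
Proof. by move=> fl c x y; rewrite fl linearP. Qed.

Lemma linear_mull (A : fdAlgType k) (f : U -> A) (z : A) :
  linear f -> linear (fun x => f x * z).
Proof. by move=> fl c x y; rewrite fl mulrDl fdalg_scalerAl. Qed.

Lemma linear_mulr (A : fdAlgType k) (f : U -> A) (z : A) :
  linear f -> linear (fun x => z * f x).
Proof. by move=> fl c x y; rewrite fl mulrDr fdalg_scalerAr. Qed.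

Lemma linear_scalel (f : U -> k^o) (v : V) :
  linear f -> linear (fun x => (f x : k) *: v).
Proof. by move=> fl c x y; rewrite fl scalerDl scalerA. Qed.

Lemma linear_scaler (f : U -> V) (c : k) :
  linear f -> linear (fun x => c *: f x).
Proof. by move=> fl d x y; rewrite fl scalerDr !scalerA mulrC. Qed.

Lemma linear_tensl (f : U -> V) (v : W) :
  linear f -> linear (fun x => tens (f x) v).
Proof. by move=> fl c x y; rewrite fl tens_linearl. Qed.

Lemma linear_tensr (f : U -> V) (v : W) :
  linear f -> linear (fun x => tens v (f x)).
Proof. by move=> fl c x y; rewrite fl tens_linearr. Qed.

Lemma linear_tlift (X : vectType k) (F : V -> W -> X) (f : U -> tensor V W) :
  linear f -> linear (fun x => tlift F (f x)).
Proof. by move=> fl c x y; rewrite fl tlift_linear. Qed.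

Lemma linear_tlift_fun (X Y : vectType k) (F : U -> X -> Y -> V) t :
  (forall u v, linear (fun x => F x u v)) -> linear (fun x => tlift (F x) t).
Proof.
move=> Fl c x y; rewrite /tlift scaler_sumr -big_split; apply: eq_bigr => i _.
rewrite scaler_sumr -big_split; apply: eq_bigr => j _ /=.
by rewrite Fl scalerDr !scalerA mulrC.
Qed.

Lemma tlift_eq (F G : U -> V -> W) t :
  (forall u v, F u v = G u v) -> tlift F t = tlift G t.
Proof.
by move=> FG; apply: eq_bigr => i _; apply: eq_bigr => j _; rewrite FG.
Qed.

Lemma linear_of_tlift (X : vectType k) (f : W -> X) (F : U -> V -> W) t :
  linear f -> f (tlift F t) = tlift (fun u v => f (F u v)) t.
Proof.
move=> fl.
pose fL : {linear W -> X} := HB.pack f (GRing.isLinear.Build _ _ _ _ _ fl).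
rewrite -[f _]/(fL _) linear_sum; apply: eq_bigr => i _.
by rewrite linear_sum; apply: eq_bigr => j _; rewrite linearZ.
Qed.

Lemma tlift_exchange (X Y Z : vectType k) (F : U -> V -> X -> Y -> Z) s t :
  tlift (fun u v => tlift (F u v) s) t =
  tlift (fun x y => tlift (fun u v => F u v x y) t) s.
Proof.
rewrite /tlift.
under eq_bigr => i _ do under eq_bigr => j _ do rewrite scaler_sumr.
under eq_bigr => i _ do rewrite exchange_big.
rewrite exchange_big; apply: eq_bigr => p _.
under eq_bigr => i _ do under eq_bigr => j _ do rewrite scaler_sumr.
under eq_bigr => i _ do rewrite exchange_big.
rewrite exchange_big; apply: eq_bigr => q _.
rewrite scaler_sumr; apply: eq_bigr => i _.
rewrite scaler_sumr; apply: eq_bigr => j _.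
by rewrite !scalerA mulrC.
Qed.

Lemma tlift_ext (F G : tensor U V -> W) t : linear F -> linear G ->
  (forall u v, F (tens u v) = G (tens u v)) -> F t = G t.
Proof.
move=> Fl Gl FG.
pose FL : {linear tensor U V -> W} :=
  HB.pack F (GRing.isLinear.Build _ _ _ _ _ Fl).
pose GL : {linear tensor U V -> W} :=
  HB.pack G (GRing.isLinear.Build _ _ _ _ _ Gl).
exact: (@tensor_ext _ _ _ _ FL GL).
Qed.

End Linear.

(** * Sweedler sums and the antipode without visible transports *)

Section Sweedler.
Variables (k : fieldType) (pi : groupType) (H : hopfPiCoalgebra k pi).
Implicit Types (a b c d : pi) (W : vectType k).

(* Sweedler notation: [sw e x F] is the sum of the F x_(1) x_(2), where
   x_(1) (x) x_(2) is the coproduct of x; the proof e : c = a * b is an argument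
   so that no transport shows up in the formulas. *)
Definition sw a b c (e : c = (a * b)%g) (W : vectType k) (x : H c)
    (F : H a -> H b -> W) : W :=
  tlift F (comul H a b (tr (hpc_alg H) e x)).

(** The target index [b] is only required to equal [a^-1], so that [anti eSb (anti eSa x)] is the
    squared antipode with values in [H a] itself. *)
Definition anti a b (e : b = a^-1%g) (x : H a) : H b :=
  tr (hpc_alg H) (esym e) (antipode H a x).

Lemma linear_sw (U : vectType k) a b c (e : c = (a * b)%g) W
    (F : H a -> H b -> W) (f : U -> H c) :
  linear f -> linear (fun x => sw e (f x) F).
Proof.
by move=> fl z x y; rewrite /sw fl tr_linear linearP tlift_linear.
Qed.

Lemma linear_sw_fun (U : vectType k) a b c (e : c = (a * b)%g) W x
    (F : U -> H a -> H b -> W) :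
  (forall u v, linear (fun z => F z u v)) -> linear (fun z => sw e x (F z)).
Proof. exact: linear_tlift_fun. Qed.

Lemma swZ a b c (e : c = (a * b)%g) W (F : H a -> H b -> W) z x :
  sw e (z *: x) F = z *: sw e x F.
Proof. exact: (scale_linear _ _ (linear_sw e F (@linear_id _ _))). Qed.

Lemma linear_anti (U : vectType k) a b (e : b = a^-1%g) (f : U -> H a) :
  linear f -> linear (fun x => anti e (f x)).
Proof. by move=> fl z x y; rewrite /anti fl linearP tr_linear. Qed.

Lemma sw_eq a b c (e : c = (a * b)%g) W x (F G : H a -> H b -> W) :
  (forall u v, F u v = G u v) -> sw e x F = sw e x G.
Proof. exact: tlift_eq. Qed.

Lemma linear_of_sw a b c (e : c = (a * b)%g) (W X : vectType k) (f : W -> X) x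
    (F : H a -> H b -> W) :
  linear f -> f (sw e x F) = sw e x (fun u v => f (F u v)).
Proof. exact: linear_of_tlift. Qed.

Lemma sw_exchange a b c a' b' c' (e : c = (a * b)%g) (e' : c' = (a' * b')%g)
    W x y (F : H a -> H b -> H a' -> H b' -> W) :
  sw e x (fun u v => sw e' y (F u v)) =
  sw e' y (fun p q => sw e x (fun u v => F u v p q)).
Proof. exact: tlift_exchange. Qed.

End Sweedler.

(** Proves linearity side conditions by descending through the syntax of the term; the last branch
    falls back on linearity hypotheses of the context, composed with inner maps. *)
Ltac lin := repeat (cbv beta; intros; first
  [ apply: linear_id
  | assumption
  | apply: tlift_linear
  | apply: linear_lfun | apply: linear_mull | apply: linear_mulr
  | apply: linear_scalel | apply: linear_scaler
  | apply: linear_anti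
  | apply: linear_sw | apply: linear_sw_fun
  | apply: linear_tensl | apply: linear_tensr
  | apply: linear_tlift | apply: linear_tlift_fun
  | match goal with Hl : _ |- _ => first [ solve [apply: Hl]
      | apply: (linear_comp Hl) | apply: (linear_comp (Hl _))
      | apply: (linear_comp (Hl _ _)) ] end ]).

(** * The Hopf axioms in Sweedler form *)

Section Laws.
Variables (k : fieldType) (pi : groupType) (H : hopfPiCoalgebra k pi).
Implicit Types (a b c d : pi) (W : vectType k).

(** The coassociativity axiom is an equation of tensors; a trilinear [F] induces a linear map on the
    triple tensor product, which is applied to both of its sides. *)
Lemma sw_assoc a b c ab bc d (e1 : d = (ab * c)%g) (e2 : ab = (a * b)%g)
    (e3 : d = (a * bc)%g) (e4 : bc = (b * c)%g) W
    (F : H a -> H b -> H c -> W) x :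
  (forall v w, linear (fun u => F u v w)) ->
  (forall u w, linear (fun v => F u v w)) ->
  (forall u v, linear (fun w => F u v w)) ->
  sw e1 x (fun u w => sw e2 u (fun p q => F p q w)) =
  sw e3 x (fun p v => sw e4 v (fun q w => F p q w)).
Proof.
move=> F1 F2 F3; subst ab bc d.
rewrite (eq_irrelevance e3 (esym (mulgA a b c))).
pose G := tlift (fun p => tlift (F p)).
have Gl : linear G by rewrite /G; lin.
have := congr1 G (pic_comulA (hpc_coalg H) x).
set t := pic_comul _ _ _ _; set s := pic_comul _ _ _ _ => Gts.
(* [L] and [R] are the two sides of the goal as functions of the outer coproduct; being linear, they
   can be compared with [G] on pure tensors. *)
pose L t := tlift (fun u w => tlift (fun p q => F p q w) (comul H a b u)) t.
pose R t := tlift (fun p v => tlift (fun q w => F p q w) (comul H b c v)) t.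
suff [EL ER] : L t = G (tassoc (tmap (comul H a b) idfun t)) /\
               R s = G (tmap idfun (comul H b c) s).
  by rewrite -EL -ER in Gts.
split.
- apply: (tlift_ext (F := L) (G := fun t => G (tassoc (tmap _ _ t)))).
  + by rewrite /L; lin.
  + by rewrite /G /tassoc /tmap; lin.
  move=> u w; rewrite tmap_tens; [|exact: linearP|by []].
  rewrite /G /L /tassoc !tlift_tens; [|by lin..].
  rewrite linear_of_tlift; last by lin.
  by apply: tlift_eq => p q; rewrite !tlift_tens; lin.
apply: (tlift_ext (F := R) (G := fun s => G (tmap _ _ s))).
+ by rewrite /R; lin.
+ by rewrite /G /tmap; lin.
move=> u v; rewrite tmap_tens; [|by []|exact: linearP].
by rewrite /G /R !tlift_tens; lin.
Qed.

Lemma sw_counitr a (e : a = (a * 1)%g) (x : H a) :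
  sw e x (fun u v => (counit H v : k) *: u) = x.
Proof.
rewrite /sw (eq_irrelevance e (esym (mulg1 a))).
exact: (pic_counitr (hpc_coalg H) x).
Qed.

Lemma sw_counitl a (e : a = (1 * a)%g) (x : H a) :
  sw e x (fun u v => (counit H u : k) *: v) = x.
Proof.
rewrite /sw (eq_irrelevance e (esym (mul1g a))).
exact: (pic_counitl (hpc_coalg H) x).
Qed.

Lemma tr_mul a b (e : a = b) (x y : H a) :
  tr (hpc_alg H) e (x * y) = tr (hpc_alg H) e x * tr (hpc_alg H) e y.
Proof. by case: b / e. Qed.

Lemma sw_mul a b c (e : c = (a * b)%g) W (F : H a -> H b -> W) x y :
  (forall v, linear (fun u => F u v)) -> (forall u, linear (F u)) ->
  sw e (x * y) F =
  sw e x (fun x1 x2 => sw e y (fun y1 y2 => F (x1 * y1) (x2 * y2))).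
Proof.
move=> Fl Fr; rewrite /sw tr_mul hpc_comulM /tensor_mul.
rewrite linear_of_tlift; last by lin.
apply: tlift_eq => x1 x2; rewrite linear_of_tlift; last by lin.
by apply: tlift_eq => y1 y2; rewrite tlift_tens; lin.
Qed.

Lemma sw_one a b c (e : c = (a * b)%g) W (F : H a -> H b -> W) :
  (forall v, linear (fun u => F u v)) -> (forall u, linear (F u)) ->
  sw e 1 F = F 1 1.
Proof.
move=> Fl Fr; subst c; rewrite /sw /comul.
by rewrite -[tr _ _ _]/(1 : H (a * b)%g) hpc_comul1 tlift_tens; lin.
Qed.

Lemma sw_antil a b (e : 1%g = (b * a)%g) (e' : a = b^-1%g) (x : H 1%g) :
  sw e x (fun u v => anti e' u * v) = (counit H x : k) *: (1 : H a).
Proof.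
have E : b = a^-1%g by rewrite e' invgK.
subst b; rewrite /sw (eq_irrelevance e (esym (mulVg a))).
rewrite -[RHS]hpc_antipodel /anti (eq_irrelevance (esym e') (invgK a)).
rewrite /talg_mul /tmap linear_of_tlift; last by lin.
apply: tlift_eq => u v; rewrite tlift_tens //; lin.
Qed.

Lemma sw_antir a b (e : 1%g = (a * b)%g) (e' : a = b^-1%g) (x : H 1%g) :
  sw e x (fun u v => u * anti e' v) = (counit H x : k) *: (1 : H a).
Proof.
have E : b = a^-1%g by rewrite e' invgK.
subst b; rewrite /sw (eq_irrelevance e (esym (mulgV a))).
rewrite -[RHS]hpc_antipoder /anti (eq_irrelevance (esym e') (invgK a)).
rewrite /talg_mul /tmap linear_of_tlift; last by lin.
apply: tlift_eq => u v; rewrite tlift_tens //; lin.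
Qed.

Section Applied.
Variables (W : vectType k) (a : pi) (f : H a -> W).
Hypothesis fl : linear f.

Lemma sw_counitr_app (e : a = (a * 1)%g) x :
  sw e x (fun u v => (counit H v : k) *: f u) = f x.
Proof.
rewrite -[in RHS](sw_counitr e x) (linear_of_sw e (f := f)) //.
by apply: sw_eq => u v; rewrite scale_linear.
Qed.

Lemma sw_counitl_app (e : a = (1 * a)%g) x :
  sw e x (fun u v => (counit H u : k) *: f v) = f x.
Proof.
rewrite -[in RHS](sw_counitl e x) (linear_of_sw e (f := f)) //.
by apply: sw_eq => u v; rewrite scale_linear.
Qed.

Lemma sw_antil_app b (e : 1%g = (b * a)%g) (e' : a = b^-1%g) x :
  sw e x (fun u v => f (anti e' u * v)) = (counit H x : k) *: f 1.
Proof.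
by rewrite -scale_linear // -(sw_antil e e') (linear_of_sw e (f := f)).
Qed.

Lemma sw_antir_app b (e : 1%g = (a * b)%g) (e' : a = b^-1%g) x :
  sw e x (fun u v => f (u * anti e' v)) = (counit H x : k) *: f 1.
Proof.
by rewrite -scale_linear // -(sw_antir e e') (linear_of_sw e (f := f)).
Qed.

End Applied.

End Laws.

(** * Nondegenerate bilinear forms on finite dimensional spaces *)

Section Duality.
Variable k : fieldType.
Implicit Types U V W : vectType k.

Lemma linear_inj_surj V W (f : V -> W) : linear f ->
  (forall v, f v = 0 -> v = 0) -> (\dim {:W} <= \dim {:V})%N ->
  forall w, exists v, f v = w.
Proof.
move=> fl finj leWV w.
pose fL : {linear V -> W} := HB.pack f (GRing.isLinear.Build _ _ _ _ _ fl).
have fE v : linfun fL v = f v by rewrite lfunE.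
have ker0 : lker (linfun fL) == 0%VS.
  apply/lker0P=> u v; rewrite !fE => fuv.
  apply/eqP; rewrite -subr_eq0; apply/eqP/finj.
  by rewrite -[f _]/(fL _) linearB /= fuv subrr.
have : w \in limg (linfun fL).
  suff -> : limg (linfun fL) = fullv by exact: memvf.
  apply/eqP; rewrite eqEdim subvf limg_dim_eq //.
  by rewrite (eqP ker0) capv0.
by case/memv_imgP=> v _ ->; exists v; rewrite fE.
Qed.

Lemma linear_inj_dim V W (f : V -> W) : linear f ->
  (forall v, f v = 0 -> v = 0) -> (\dim {:V} <= \dim {:W})%N.
Proof.
move=> fl finj.
pose fL : {linear V -> W} := HB.pack f (GRing.isLinear.Build _ _ _ _ _ fl).
have ker0 : lker (linfun fL) == 0%VS.
  apply/lker0P=> u v; rewrite !lfunE /= => fuv.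
  apply/eqP; rewrite -subr_eq0; apply/eqP/finj.
  by rewrite -[f _]/(fL _) linearB /= fuv subrr.
have <- : \dim (limg (linfun fL)) = \dim {:V}.
  by rewrite limg_dim_eq // (eqP ker0) capv0.
exact/dimvS/subvf.
Qed.

Lemma coord_eq0 V (v : V) :
  (forall i, coord (vbasis {:V}) i v = 0) -> v = 0.
Proof.
move=> v0; rewrite (coord_vbasis (memvf v)) big1 // => i _.
by rewrite v0 scale0r.
Qed.

Variables (V : vectType k) (b : V -> V -> k^o).
Hypothesis bl : forall v, linear (fun u => b u v).
Hypothesis br : forall u, linear (b u).

(** The map sending [u] to the form [b u] is an injection of [V] into its dual, which has the same
    dimension. *)
Lemma form_surjl : (forall u, (forall v, b u v = 0) -> u = 0) ->
  forall f : 'Hom(V, k^o), exists u, forall v, b u v = f v.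
Proof.
move=> binj f.
pose bR u : {linear V -> k^o} :=
  HB.pack (b u) (GRing.isLinear.Build _ _ _ _ _ (br u)).
pose F u : 'Hom(V, k^o) := linfun (bR u).
have FE u v : F u v = b u v by rewrite lfunE.
have Fl : linear F.
  by move=> c u v; apply/lfunP=> w; rewrite add_lfunE scale_lfunE !FE bl.
have Finj u : F u = 0 -> u = 0.
  by move=> Fu0; apply: binj => v; rewrite -FE Fu0 zero_lfunE.
have dimF : (\dim {:'Hom(V, k^o)} <= \dim {:V})%N.
  by rewrite !dimvf -[leqLHS]/(dim V * 1)%N muln1.
have [u <-] := linear_inj_surj Fl Finj dimF f.
by exists u => v; rewrite FE.
Qed.

(** Each coordinate form is some [b u], so all coordinates of [v] vanish. *)
Lemma form_nondegr : (forall u, (forall v, b u v = 0) -> u = 0) ->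
  forall v, (forall u, b u v = 0) -> v = 0.
Proof.
move=> binj v v0; apply: coord_eq0 => i.
pose ci : {linear V -> k^o} := coord (vbasis {:V}) i.
have [u buE] := form_surjl binj (linfun ci).
by rewrite -[LHS]/(ci v) -(lfunE ci) -buE.
Qed.

End Duality.

Lemma form_surjr (k : fieldType) (V : vectType k) (b : V -> V -> k^o) :
    (forall v, linear (fun u => b u v)) -> (forall u, linear (b u)) ->
    (forall u, (forall v, b u v = 0) -> u = 0) ->
  forall f : 'Hom(V, k^o), exists v, forall u, b u v = f u.
Proof.
move=> bl br binj.
exact: (form_surjl (b := fun u v => b v u) br bl (form_nondegr bl br binj)).

Qed.

(** * Moving linear operations through Sweedler sums *)

Section Push.
Variables (k : fieldType) (pi : groupType) (H : hopfPiCoalgebra k pi).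
Variables (a b c : pi) (e : c = (a * b)%g) (x : H c).
Implicit Types (W : vectType k) (A : fdAlgType k).

Lemma sw_mull A (F : H a -> H b -> A) z :
  sw e x F * z = sw e x (fun u v => F u v * z).
Proof. by apply: (linear_of_sw e (f := fun t : A => t * z)); lin. Qed.

Lemma sw_mulr A (F : H a -> H b -> A) z :
  z * sw e x F = sw e x (fun u v => z * F u v).
Proof. by apply: (linear_of_sw e (f := fun t : A => z * t)); lin. Qed.

Lemma sw_scalel W (F : H a -> H b -> k^o) (z : W) :
  (sw e x F : k) *: z = sw e x (fun u v => (F u v : k) *: z).
Proof. by apply: (linear_of_sw e (f := fun t : k^o => (t : k) *: z)); lin. Qed.

Lemma sw_scaler W (F : H a -> H b -> W) (z : k) :
  z *: sw e x F = sw e x (fun u v => z *: F u v).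
Proof. by apply: (linear_of_sw e (f := fun t : W => z *: t)); lin. Qed.

Lemma sw_lfun W (X : vectType k) (h : 'Hom(W, X)) (F : H a -> H b -> W) :
  h (sw e x F) = sw e x (fun u v => h (F u v)).
Proof. by apply: (linear_of_sw e (f := h)); lin. Qed.

Lemma sw_anti d d' (eS : d' = d^-1%g) (F : H a -> H b -> H d) :
  anti eS (sw e x F) = sw e x (fun u v => anti eS (F u v)).
Proof. by apply: (linear_of_sw e (f := anti eS)); lin. Qed.

Lemma sw_sum W n (F : 'I_n -> H a -> H b -> W) :
  sw e x (fun u v => \sum_i F i u v) = \sum_i sw e x (F i).
Proof.
rewrite /sw /tlift.
under eq_bigr => p _ do under eq_bigr => q _ do rewrite scaler_sumr.
under eq_bigr => p _ do rewrite exchange_big.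
exact: exchange_big.
Qed.

(** The hypothesis concerns a fixed second argument of [f]. Expanding [G v] in a basis of [W]
    reduces to this case, since each coordinate of [G v] is a linear form in [v] that can be pulled
    out of the sum. *)
Lemma sw_contract W (f : H a -> W -> k^o) (G : H b -> W) :
    (forall u, linear (f u)) -> linear G ->
  (forall y, sw e x (fun u v => (f u y : k) *: v) = 0) ->
  sw e x (fun u v => f u (G v)) = 0.
Proof.
move=> fl Gl f0.
pose cG i v : k^o := coord (vbasis {:W}) i (G v).
have cGl i : linear (cG i) by move=> z u v; rewrite /cG Gl linearP.
transitivity (sw e x (fun u v =>
    \sum_(i < \dim {:W}) (f u (vbasis {:W})`_i : k) *: cG i v)).
  apply: sw_eq => u v; rewrite {1}(coord_vbasis (memvf (G v))).
  pose fu : {linear W -> k^o} :=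
    HB.pack (f u) (GRing.isLinear.Build _ _ _ _ _ (fl u)).
  rewrite -[f u _]/(fu _) linear_sum; apply: eq_bigr => i _.
  by rewrite linearZ /= [LHS]mulrC.
rewrite sw_sum big1 // => i _.
under sw_eq => u v do rewrite -(scale_linear _ _ (cGl i)).
rewrite -(linear_of_sw e (f := cG i)) // f0.
by rewrite -[0](scale0r (0 : H b)) scale_linear // scale0r.
Qed.

Lemma antiZ d d' (eS : d' = d^-1%g) z (y : H d) :
  anti eS (z *: y) = z *: anti (H := H) eS y.
Proof. by subst d'; rewrite /anti linearZ. Qed.

End Push.

(** * Right integrals: vanishing, nondegeneracy on [H 1], and a normalised left integral *)

Section Integral.
Variables (k : fieldType) (pi : groupType) (H : hopfPiCoalgebra k pi).
Variable lam : forall a : pi, 'Hom(H a, k^o).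
Hypothesis lamI : right_pi_integral H lam.

Lemma sw_integral a b c (e : c = (a * b)%g) (x : H c) :
  sw e x (fun u v => (lam a u : k) *: v) = (lam c x : k) *: (1 : H b).
Proof. by subst c; exact: lamI. Qed.

Lemma integral_eq0 : lam 1%g = 0 -> forall a (x : H a), lam a x = 0.
Proof.
move=> lam0 a x; have := sw_integral (esym (mul1g a)) x.
rewrite [LHS](_ : _ = 0); last first.
  by rewrite lam0 /sw /tlift big1 // => i _; rewrite big1 // => j _;
    rewrite zero_lfunE scale0r scaler0.
(* [H a] may be the zero algebra, so [1] cannot be cancelled from [lam a x *: 1 = 0]; multiplying by
   [x] and applying [lam a] gives that the square of [lam a x] is zero. *)
move=> /(congr1 (fun z => lam a (z * x))).
rewrite mul0r linear0 -fdalg_scalerAl mul1r linearZ => /esym/eqP.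
by rewrite mulf_eq0 orbb => /eqP.
Qed.

(** Both sides evaluate the sum of [lam a (x_(1) y_(1)) *: x_(2) y_(2) S(y_(3))]: cancelling
    [y_(2) S(y_(3))] gives the left one, and the integral property for [x y_(1)] the right one. *)
Lemma integral_mulr a b b' c (e : c = (a * b)%g) (e' : a = (c * b')%g)
    (eS : b = b'^-1%g) (x : H c) (y : H a) :
  sw e x (fun u v => (lam a (u * y) : k) *: v) =
  sw e' y (fun u v => (lam c (x * u) : k) *: anti eS v).
Proof.
have e1 : 1%g = (b * b')%g by rewrite eS mulVg.
transitivity (sw e' y (fun u v => sw e u (fun u1 u2 =>
    sw e x (fun x1 x2 => (lam a (x1 * u1) : k) *: (x2 * u2 * anti eS v))))).
  rewrite (sw_assoc _ _ (esym (mulg1 a)) e1); [|lin..].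
  rewrite -{1}(sw_counitr (esym (mulg1 a)) y).
  under [LHS]sw_eq => u v do rewrite sw_mulr sw_lfun sw_scalel.
  rewrite sw_exchange; apply: sw_eq => u w.
  rewrite [RHS]sw_exchange; apply: sw_eq => x1 x2.
  under sw_eq => ? ? do rewrite -mulrA.
  rewrite -sw_scaler -sw_mulr sw_antir -!fdalg_scalerAr mulr1 linearZ /=.
  by rewrite !scalerA mulrC.
apply: sw_eq => u v; rewrite -[RHS]mul1r -fdalg_scalerAr fdalg_scalerAl.
rewrite -(sw_integral e) sw_mull sw_mul; [|lin..]. rewrite sw_exchange.
by apply: sw_eq => x1 x2; apply: sw_eq => y1 y2; rewrite -fdalg_scalerAl.
Qed.

(* Sweedler form of: the left radical of the form lam (x y) is a right ideal and
   a right coideal, so it contains eps (x_(1)) x_(2) = x once it contains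
   x_(1) S (x_(2)). *)
Lemma integral_nondeg1 : lam 1%g != 0 ->
  forall x : H 1%g, (forall y, lam 1%g (x * y) = 0) -> x = 0.
Proof.
move=> lam_neq0 x x0.
have e : 1%g = (1 * 1)%g :> pi by rewrite mulg1.
have eS : 1%g = 1^-1%g :> pi by rewrite invg1.
apply: coord_eq0 => i.
pose f : {linear H 1%g -> k^o} := coord (vbasis {:H 1%g}) i.
have fl : linear f by exact: linearP.
rewrite -[LHS]/(f x); apply/eqP; apply: contraNT lam_neq0 => fx.
apply/eqP/lfunP=> y; rewrite zero_lfunE.
suff /eqP : (f x : k) *: lam 1%g y = 0 by rewrite mulf_eq0 (negPf fx) => /eqP.
(* [G] is chosen so that the sum of [lam 1 (x_(1) G(x_(2)))] collapses to [f x * lam 1 y], while it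
   vanishes by [sw_contract]. *)
pose G w := sw e w (fun u v => (f v : k) *: (anti eS u * y)).
have <- : sw e x (fun u w => lam 1%g (u * G w)) = 0.
  apply: (sw_contract (f := fun u w => lam 1%g (u * w)));
    try by rewrite /G; lin.
  move=> z; rewrite (integral_mulr e e eS) /sw /tlift big1 // => p _.
  by rewrite big1 // => q _; rewrite x0 scale0r scaler0.
transitivity (sw e x (fun u v => (f v : k) *: lam 1%g ((counit H u : k) *: y))).
  rewrite -{1}(sw_counitl e x) (linear_of_sw e (f := f)) // sw_scalel.
  apply: sw_eq => u v; rewrite !linearZ /=. exact: esym (mulrA _ _ _).
under sw_eq => u v do rewrite -[y in lam _ (_ *: y)]mul1r fdalg_scalerAl
  -(sw_antir e eS) sw_mull sw_lfun sw_scaler.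
rewrite (sw_assoc _ _ e e); [|lin..].
by apply: sw_eq => u w; rewrite /G sw_mulr sw_lfun; apply: sw_eq => p q;
  rewrite -fdalg_scalerAr linearZ mulrA.
Qed.

(** [L] is the element representing the counit: [lam 1 (y * L) = counit y]. Then
    [x * L - counit x *: L] lies in the radical of the form because the counit is multiplicative. *)
Lemma left_integral_exists : lam 1%g != 0 ->
  exists L : H 1%g, left_integral L /\ lam 1%g L = 1.
Proof.
move=> lam_neq0; have nondeg := integral_nondeg1 lam_neq0.
pose b (x y : H 1%g) := lam 1%g (x * y).
have bl y : linear (fun x => b x y) by rewrite /b; lin.
have br x : linear (b x) by rewrite /b; lin.
have [L LE] := form_surjr bl br nondeg (counit H).
exists L; split; last by rewrite -[L]mul1r -[LHS]/(b 1 L) LE hpc_counit1.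
move=> x; apply/eqP; rewrite -subr_eq0; apply/eqP.
apply: (form_nondegr bl br nondeg) => y.
rewrite /b mulrBr linearB mulrA -fdalg_scalerAr linearZ /=.
by rewrite -![lam _ _]/(b _ L) !LE hpc_counitM [X in X - _]mulrC subrr.
Qed.

End Integral.

(** * Commutation relations for the coproduct of a left integral *)

Section LeftIntegral.
Variables (k : fieldType) (pi : groupType) (H : hopfPiCoalgebra k pi).
Variables (L : H 1%g) (a b : pi).
Hypothesis Lint : left_integral L.
Hypotheses (eab : 1%g = (a * b)%g) (eSa : b = a^-1%g) (eSb : a = b^-1%g).

(* Both sides equal the coproduct of x_(2) L multiplied by S (x_(1)) on the left
   of its first factor. *)
Lemma left_integral_comul (W : vectType k) (x : H b) (F : H a -> H b -> W) :
    (forall v, linear (fun u => F u v)) -> (forall u, linear (F u)) ->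
  sw eab L (fun u v => F u (x * v)) =
  sw eab L (fun u v => F (anti eSb x * u) v).
Proof.
move=> F1 F2.
have eba : 1%g = (b * a)%g by rewrite eSa mulVg.
pose G x1 x2 x3 := sw eab L (fun u v => F (anti eSb x1 * x2 * u) (x3 * v)).
pose A x := sw eab L (fun u v => F u (x * v)).
pose B x := sw eab L (fun u v => F (anti eSb x * u) v).
rewrite -[LHS]/(A x) -[RHS]/(B x).
rewrite -(sw_counitl_app _ (esym (mul1g b))); last by rewrite /A; lin.
rewrite -(sw_counitr_app _ (esym (mulg1 b))); last by rewrite /B; lin.
transitivity (sw (esym (mul1g b)) x (fun v x3 =>
    sw eba v (fun x1 x2 => G x1 x2 x3))).
  apply: sw_eq => v x3; rewrite /G sw_exchange /A sw_scaler.
  apply: sw_eq => p q.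
  have Fl : linear (fun z : H a => F (z * p) (x3 * q)) by lin.
  by rewrite -[X in F X _](mul1r p) -(sw_antil_app Fl eba eSb).
rewrite (sw_assoc _ _ (esym (mulg1 b)) eab); [|rewrite /G; lin..].
apply: sw_eq => u v.
transitivity (sw eab (v * L) (fun p q => F (anti eSb u * p) q)).
  rewrite sw_mul; [|lin..].
  by apply: sw_eq => x2 x3; apply: sw_eq => p q; rewrite mulrA.
by rewrite Lint swZ.
Qed.
(* Expand L y_(1) = nu (y_(1)) L inside L_(1) y_(1) (x) L_(2) y_(2) S (y_(3)). *)
Lemma left_integral_comul_hit (W : vectType k) (nu : 'Hom(H 1%g, k^o)) (y : H a)
    (F : H a -> H b -> W) :
    (forall x, L * x = (nu x : k) *: L) ->
    (forall v, linear (fun u => F u v)) -> (forall u, linear (F u)) ->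
  sw eab L (fun u v => F (u * y) v) =
  sw eab L (fun u v => F u (v * anti eSa (hitr y nu))).
Proof.
move=> Lnu F1 F2.
have eba : 1%g = (b * a)%g by rewrite eSa mulVg.
pose G y1 y2 y3 := sw eab L (fun u v => F (u * y1) (v * (y2 * anti eSa y3))).
pose A y := sw eab L (fun u v => F (u * y) v).
pose B y := sw eab L (fun u v => F u (v * anti eSa y)).
have Bl : linear B by rewrite /B; lin.
rewrite -[LHS]/(A y) -[RHS]/(B _).
rewrite -(sw_counitr_app _ (esym (mulg1 a))); last by rewrite /A; lin.
transitivity (sw (esym (mulg1 a)) y (fun y1 v =>
    sw eba v (fun y2 y3 => G y1 y2 y3))).
  apply: sw_eq => y1 v; rewrite /G sw_exchange /A sw_scaler.
  apply: sw_eq => p q.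
  have Fl : linear (fun z : H b => F (p * y1) (q * z)) by lin.
  by rewrite -[X in F _ X](mulr1 q) -(sw_antir_app Fl eba eSa).
rewrite -(sw_assoc (esym (mul1g a)) eab); [|rewrite /G; lin..].
rewrite -[hitr y nu]/(sw (esym (mul1g a)) y (fun u v => (nu u : k) *: v)).
rewrite (linear_of_sw _ (f := B)) //; apply: sw_eq => u v.
rewrite scale_linear // /B -swZ -Lnu sw_mul; [|lin..].
rewrite /G [LHS]sw_exchange; apply: sw_eq => p q; apply: sw_eq => x1 x2.
by rewrite mulrA.
Qed.

End LeftIntegral.

(** * Dual bases from integrals, bijectivity of the antipode, and part (a) *)

Section Frobenius.
Variables (k : fieldType) (pi : groupType) (H : hopfPiCoalgebra k pi).
Variable lam : forall a : pi, 'Hom(H a, k^o).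
Hypothesis lamI : right_pi_integral H lam.
Variable L : H 1%g.
Hypotheses (Lint : left_integral L) (lamL : lam 1%g L = 1).

Section Pair.
Variables a b : pi.
Hypotheses (eab : 1%g = (a * b)%g) (eSa : b = a^-1%g) (eSb : a = b^-1%g).

Lemma sw_integrals : sw eab L (fun u v => (lam a u : k) *: v) = 1.
Proof. by rewrite sw_integral // lamL scale1r. Qed.

(** [left_integral_comul] turns [S(x)] before [L_(1)] into [x] before [L_(2)], and
    [lam a (L_(1)) *: L_(2)] sums to [1]. *)
Lemma antipode_dual (x : H b) :
  sw eab L (fun u v => (lam a (anti eSb x * u) : k) *: v) = x.
Proof.
rewrite -(left_integral_comul Lint eab eSa eSb x
  (F := fun u v => (lam a u : k) *: v)); [|lin..].
under sw_eq => u v do rewrite fdalg_scalerAr.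
by rewrite -sw_mulr sw_integrals mulr1.
Qed.

Lemma anti_inj (x : H b) : anti eSb x = 0 -> x = 0.
Proof.
move=> Sx0; rewrite -[x]antipode_dual Sx0 /sw /tlift big1 // => i _.
by rewrite big1 // => j _; rewrite mul0r linear0 scale0r scaler0.
Qed.

End Pair.

Section Pair.
Variables a b : pi.
Hypotheses (eab : 1%g = (a * b)%g) (eSa : b = a^-1%g) (eSb : a = b^-1%g).

(** The antipodes from [H b] to [H a] and from [H a] to [H b] are both injective, so the dimensions
    agree. *)
Lemma anti_surj (z : H a) : exists x : H b, anti eSb x = z.
Proof.
have eba : 1%g = (b * a)%g by rewrite eSa mulVg.
apply: linear_inj_surj; [by lin | exact: anti_inj |].
apply: (linear_inj_dim (f := anti eSa)); [by lin | exact: anti_inj].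
Qed.

(** This is the image of [antipode_dual] under the antipode, with [z = S(x)]. *)
Lemma frobenius_dual (z : H a) :
  sw eab L (fun u v => (lam a (z * u) : k) *: anti eSb v) = z.
Proof.
have [x <-] := anti_surj z.
rewrite -[in RHS](antipode_dual eab eSa eSb x) sw_anti.
by apply: sw_eq => u v; rewrite antiZ.
Qed.

Lemma integral_nondegl (z : H a) : (forall y, lam a (z * y) = 0) -> z = 0.
Proof.
move=> z0; rewrite -[z]frobenius_dual /sw /tlift big1 // => i _.
by rewrite big1 // => j _; rewrite z0 scale0r scaler0.
Qed.

Lemma integral_nondegr (z : H a) : (forall y, lam a (y * z) = 0) -> z = 0.
Proof.
pose m (u v : H a) := lam a (u * v).
have ml v : linear (fun u => m u v) by rewrite /m; lin.
have mr u : linear (m u) by rewrite /m; lin.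
exact: (form_nondegr ml mr integral_nondegl).
Qed.

(** By nondegeneracy it suffices to pair with any [w] on the left; expanding [w] by [frobenius_dual]
    gives the same sum of products [lam a (w L_(1)) * lam a (S(L_(2)) z)]. *)
Lemma frobenius_dual_swap (z : H a) :
  sw eab L (fun u v => (lam a (anti eSb v * z) : k) *: u) = z.
Proof.
apply/eqP; rewrite -subr_eq0; apply/eqP/integral_nondegr => w.
rewrite mulrBr linearB /= sw_mulr sw_lfun.
rewrite -[in X in _ - X](frobenius_dual w) sw_mull sw_lfun.
apply/eqP; rewrite subr_eq0; apply/eqP/sw_eq => u v.
rewrite -fdalg_scalerAr -fdalg_scalerAl !linearZ /=; exact: mulrC.
Qed.

(** Multiplying [L_(2)] by [1] amounts to multiplying [L_(1)] by [S(1)], and [frobenius_dual_swap]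
    reads off the latter factor. *)
Lemma anti_one : anti eSb 1 = 1 :> H a.
Proof.
pose F (u : H a) (v : H b) : H a := (lam a (anti eSb v * 1) : k) *: u.
rewrite -[RHS](frobenius_dual_swap 1) -[RHS]/(sw eab L F).
transitivity (sw eab L (fun u v => F u (1 * v))); last first.
  by apply: sw_eq => u v; rewrite mul1r.
rewrite (left_integral_comul Lint eab eSa eSb); [|rewrite /F; lin..].
rewrite /F; under sw_eq => u v do rewrite fdalg_scalerAr.
by rewrite -sw_mulr frobenius_dual_swap mulr1.
Qed.

(* By left_integral_comul, S (x y) and S y * S x act in the same way on
   L_(1) (x) L_(2), and that action determines an element of H a. *)
Lemma anti_mul (x y : H b) : anti eSb (x * y) = anti eSb y * anti eSb x.
Proof.
pose F (u : H a) (v : H b) : H a := (lam a (anti eSb v * 1) : k) *: u.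
have FE (z : H a) : z = sw eab L (fun u v => F (z * u) v).
  rewrite /F; under sw_eq => u v do rewrite fdalg_scalerAr.
  by rewrite -sw_mulr frobenius_dual_swap mulr1.
have PF := left_integral_comul Lint eab eSa eSb.
rewrite [LHS]FE -PF; [|rewrite /F; lin..].
under sw_eq => u v do rewrite -mulrA.
rewrite (PF _ y (fun u v => F u (x * v))); [|rewrite /F; lin..].
rewrite (PF _ x (fun u v => F (anti eSb y * u) v)); [|rewrite /F; lin..].
by rewrite [RHS]FE; apply: sw_eq => u v; rewrite mulrA.
Qed.

(** After expanding [x] by [frobenius_dual_swap], the factor [y] next to [L_(1)] becomes
    [S(y <- nu)] to the right of [L_(2)]; the outer antipode reverses this product, and the sum over
    [L] collapses to [S(1) = 1]. *)
Lemma integral_nakayama (nu : 'Hom(H 1%g, k^o)) (x y : H a) :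
    (forall x, L * x = (nu x : k) *: L) ->
  lam a (x * y) = lam a (anti eSb (anti eSa (hitr y nu)) * x).
Proof.
move=> Lnu; set y' := anti eSb _.
pose F (u : H a) (v : H b) := (lam a u : k) *: lam a (anti eSb v * x).
transitivity (sw eab L (fun u v => F (u * y) v)).
  rewrite -{1}(frobenius_dual_swap x) sw_mull sw_lfun; apply: sw_eq => u v.
  by rewrite -fdalg_scalerAl linearZ [LHS]mulrC.
rewrite (left_integral_comul_hit eab eSa y Lnu); [|rewrite /F; lin..].
transitivity (lam a
  (y' * (anti eSb (sw eab L (fun u v => (lam a u : k) *: v)) * x))).
  rewrite sw_anti sw_mull sw_mulr sw_lfun; apply: sw_eq => u v.
  by rewrite /F anti_mul antiZ -fdalg_scalerAl -fdalg_scalerAr linearZ mulrA.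
by rewrite sw_integrals anti_one mul1r.
Qed.

End Pair.
End Frobenius.

(** * Harpoon actions of an algebra form and their exchange by the antipode *)

Section Hit.
Variables (k : fieldType) (pi : groupType) (H : hopfPiCoalgebra k pi).
Implicit Types (a b : pi) (nu : 'Hom(H 1%g, k^o)).

Lemma hitrE nu a (e : a = (1 * a)%g) (x : H a) :
  hitr x nu = sw e x (fun u v => (nu u : k) *: v).
Proof. by rewrite (eq_irrelevance e (esym (mul1g a))). Qed.

Lemma hitlE nu a (e : a = (a * 1)%g) (x : H a) :
  hitl nu x = sw e x (fun u v => (nu v : k) *: u).
Proof. by rewrite (eq_irrelevance e (esym (mulg1 a))). Qed.

Lemma linear_hitr nu (U : vectType k) a (f : U -> H a) :
  linear f -> linear (fun x => hitr (f x) nu).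
Proof. exact: linear_sw. Qed.

Variable nu : 'Hom(H 1%g, k^o).
Hypothesis nuA : algebra_form nu.

Lemma hitr_mul a (x y : H a) : hitr (x * y) nu = hitr x nu * hitr y nu.
Proof.
have e := esym (mul1g a); rewrite !(hitrE _ e) sw_mul; [|lin..].
rewrite sw_mull; apply: sw_eq => u v; rewrite sw_mulr; apply: sw_eq => p q.
by rewrite nuA.1 -fdalg_scalerAl -fdalg_scalerAr scalerA.
Qed.

Lemma hitr_one a : hitr (1 : H a) nu = 1.
Proof.
by rewrite (hitrE _ (esym (mul1g a))) sw_one; [rewrite nuA.2 scale1r|lin..].
Qed.

Variable nuV : 'Hom(H 1%g, k^o).
Hypothesis nuK : convolution nuV nu =1 counit H.
Variables a b : pi.
Hypotheses (eab : 1%g = (a * b)%g) (eSa : b = a^-1%g).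

(** The sum is [nuV(x_(2)) nu(x_(3)) S(x_(1)) x_(4)]: the two forms sit on adjacent factors and
    cancel under convolution, leaving [S(x_(1)) x_(2)]. *)
Lemma anti_hitl_hitr (x : H 1%g) :
  sw eab x (fun u v => anti eSa (hitl nuV u) * hitr v nu) =
  (counit H x : k) *: (1 : H b).
Proof.
have eSb : a = b^-1%g by rewrite eSa invgK.
have ea1 := esym (mulg1 a); have e1b := esym (mul1g b).
have e11 : 1%g = (1 * 1)%g :> pi by rewrite mulg1.
pose G (u : H a) v s (t : H b) : H b :=
  (nuV v : k) *: ((nu s : k) *: (anti eSa u * t)).
transitivity (sw eab x (fun u w => sw e1b w (fun v w' =>
    sw e1b w' (fun s t => G u v s t)))).
  rewrite -(sw_assoc eab ea1); [|by rewrite /G; lin..].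
  apply: sw_eq => u w; rewrite (hitlE _ ea1) sw_anti sw_mull.
  apply: sw_eq => p q; rewrite (hitrE _ e1b) sw_mulr; apply: sw_eq => s t.
  by rewrite antiZ -fdalg_scalerAl -fdalg_scalerAr.
rewrite -(sw_antil eab eSa); apply: sw_eq => u w.
rewrite -(sw_assoc e1b e11); [|by rewrite /G; lin..].
rewrite -[in RHS](sw_counitl e1b w) sw_mulr; apply: sw_eq => p t.
rewrite -fdalg_scalerAr -nuK /convolution.
rewrite (eq_irrelevance (esym (mulg1 1%g)) e11) -[tlift _ _]/(sw e11 p _).
by rewrite sw_scalel; apply: sw_eq => q s; rewrite /G scalerA.
Qed.

(* Both sides are convolution inverses of the algebra map hitr _ nu. *)
Lemma hitr_anti (x : H a) : hitr (anti eSa x) nu = anti eSa (hitl nuV x).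
Proof.
have eSb : a = b^-1%g by rewrite eSa invgK.
have eba : 1%g = (b * a)%g by rewrite eSa mulVg.
have ea1 := esym (mulg1 a); have e1a := esym (mul1g a).
pose A x := hitr (anti eSa x) nu.
pose B x := anti eSa (hitl nuV x).
have Al : linear A by apply: linear_hitr; lin.
have Bl : linear B by apply: linear_anti; apply: linear_sw; lin.
rewrite -[LHS]/(A x) -[RHS]/(B x).
rewrite -(sw_counitl_app Al e1a) -(sw_counitr_app Bl ea1).
transitivity (sw e1a x (fun w u =>
    sw eab w (fun p q => B p * hitr q nu * A u))).
  apply: sw_eq => w u; rewrite -[A u]mul1r fdalg_scalerAl -anti_hitl_hitr.
  by rewrite sw_mull mul1r.
rewrite (sw_assoc _ _ ea1 eba); first last.
- by move=> u v; lin.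
- move=> u v; apply: linear_mull; apply: linear_mulr.
  by apply: linear_hitr; lin.
- by move=> u v; lin.
apply: sw_eq => p w.
have fl : linear (fun z : H b => hitr z nu) by apply: linear_hitr; lin.
rewrite -[B p in RHS]mulr1 -hitr_one fdalg_scalerAr -(sw_antir_app fl eba eSa).
by rewrite sw_mulr; apply: sw_eq => u v; rewrite hitr_mul mulrA.
Qed.

End Hit.

(** * The distinguished grouplike element: part (c), and part (b) up to a factor [g] *)

Section Distinguished.
Variables (k : fieldType) (pi : groupType) (H : hopfPiCoalgebra k pi).
Variable lam : forall a : pi, 'Hom(H a, k^o).
Hypothesis lamI : right_pi_integral H lam.
Variable L : H 1%g.
Hypotheses (Lint : left_integral L) (lamL : lam 1%g L = 1).
Variable nu : 'Hom(H 1%g, k^o).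
Hypotheses (nuA : algebra_form nu).
Hypothesis Lnu : forall x, L * x = (nu x : k) *: L.
Variable g : forall a : pi, H a.
Hypothesis gG : pi_grouplike g.
Hypothesis lamg : forall a b (x : H (a * b)%g),
  tformr (lam b) (comul H a b x) = (lam (a * b)%g x : k) *: g a.

Lemma sw_grouplike a b c (e : c = (a * b)%g) (W : vectType k)
    (F : H a -> H b -> W) :
    (forall v, linear (fun u => F u v)) -> (forall u, linear (F u)) ->
  sw e (g c) F = F (g a) (g b).
Proof. by move=> F1 F2; rewrite /sw tr_fam gG.1 tlift_tens; lin. Qed.

Lemma sw_distinguished a b c (e : c = (a * b)%g) (x : H c) :
  sw e x (fun u v => (lam b v : k) *: u) = (lam c x : k) *: g a.
Proof. by subst c; exact: lamg. Qed.

Lemma hitr_grouplike_mul a (x : H a) :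
  hitr (g a * x) nu = (nu (g 1%g) : k) *: (g a * hitr x nu).
Proof.
rewrite hitr_mul // (hitrE nu (esym (mul1g a)) (g a)) sw_grouplike; [|lin..].
by rewrite fdalg_scalerAl.
Qed.

Lemma grouplike_form_neq0 : nu (g 1%g) != 0.
Proof.
have [gK _] := pi_grouplike_inverse gG 1%g.
apply/eqP=> g0; have := oner_neq0 k; rewrite -[1]nuA.2 -gK nuA.1 g0 mul0r.
by rewrite eqxx.
Qed.

Section Pair.
Variables a b : pi.
Hypotheses (eab : 1%g = (a * b)%g) (eSa : b = a^-1%g) (eSb : a = b^-1%g).

(** As [lam 1 L = 1], the defining property of [g] writes [g a] as the sum of
    [lam b (L_(2)) *: L_(1)]. Moving [z] across to [L_(2)] then leaves [lam a (L_(1)) *: L_(2)],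
    which sums to [1]. *)
Lemma integral_grouplike_hitr (z : H a) :
  lam a (g a * z) = lam b (anti eSa (hitr z nu)).
Proof.
pose F (u : H a) (v : H b) := (lam b v : k) *: lam a u.
transitivity (sw eab L (fun u v => F (u * z) v)).
  rewrite -[g a]scale1r -lamL -(sw_distinguished eab L) sw_mull sw_lfun.
  by apply: sw_eq => u v; rewrite -fdalg_scalerAl linearZ.
rewrite (left_integral_comul_hit eab eSa z Lnu); [|rewrite /F; lin..].
rewrite -[anti _ _ in RHS]mul1r -(sw_integrals lamI lamL eab) sw_mull sw_lfun.
apply: sw_eq => u v; rewrite -fdalg_scalerAl linearZ; exact: mulrC.
Qed.

(** Injectivity suffices for an endomorphism: if [hitr y nu = 0], part (a) gives [lam a (z * y) = 0]
    for all [z], hence [y = 0]. *)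
Lemma hitr_surj (x : H a) : exists z, hitr z nu = x.
Proof.
apply: linear_inj_surj => //; first by apply: linear_hitr; lin.
move=> y y0; apply: (integral_nondegr lamI Lint lamL eab eSa eSb) => z.
rewrite (integral_nakayama lamI Lint lamL eab eSa eSb z y Lnu) y0.
by rewrite -(scale0r (0 : H a)) !antiZ !scale0r mul0r linear0.
Qed.

(* The form z |-> lam (g z) is invariant under z |-> hitr z nu, which is onto. *)
Lemma integral_anti (x : H a) : lam b (anti eSa x) = lam a (g a * x).
Proof.
have [z <-] := hitr_surj x; rewrite -integral_grouplike_hitr.
(* The nonzero scalar [nu (g 1)] arises twice: from [hitr] acting on the factor [g a], and from
   applying [nu] to [lam a (g a * z) *: g 1], given by the property of [g] at the indices [1] and
   [a]. *)
apply: (mulfI grouplike_form_neq0).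
have e := esym (mul1g a).
have -> : nu (g 1%g) * lam a (g a * hitr z nu) = lam a (hitr (g a * z) nu).
  by rewrite hitr_grouplike_mul linearZ.
rewrite (hitrE nu e) sw_lfun.
transitivity (nu (sw e (g a * z) (fun u v => (lam a v : k) *: u))).
  by rewrite sw_distinguished linearZ mulrC.
by rewrite sw_lfun; apply: sw_eq => u v; rewrite !linearZ; exact: mulrC.
Qed.

End Pair.

Section Pair.
Variables a b : pi.
Hypotheses (eab : 1%g = (a * b)%g) (eSa : b = a^-1%g) (eSb : a = b^-1%g).

(** Part (c) carries both sides to [H b], where part (a) applies to [S(y) S(x)]; [hitr_anti] turns
    [S(x) <- nu] into [S(nuV -> x)]. *)
Lemma integral_grouplike_nakayama nuV (x y : H a) :
    convolution nuV nu =1 counit H ->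
  lam a (g a * (x * y)) =
  lam a (g a * (y * anti eSb (anti eSa (hitl nuV x)))).
Proof.
move=> nuK; have eba : 1%g = (b * a)%g by rewrite eSa mulVg.
rewrite -!(integral_anti eab eSa eSb).
rewrite !(anti_mul lamI Lint lamL eba eSb eSa).
rewrite (integral_nakayama lamI Lint lamL eba eSb eSa _ _ Lnu).
by rewrite (hitr_anti nuA nuK eab eSa).
Qed.

End Pair.
End Distinguished.

Unset Implicit Arguments.

(** * Assembly of the three identities *)

Theorem theorem4 (k : fieldType) (pi : groupType) (H : hopfPiCoalgebra k pi)
    (lam : forall a : pi, 'Hom(H a, k^o)) (g : forall a : pi, H a)
    (nu : 'Hom(H 1%g, k^o)) :
  right_pi_integral H lam ->
  distinguished_pi_grouplike H g ->
  distinguished_grouplike_dual H nu ->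
  forall (a : pi) (x y : H a),
  [/\ lam a (x * y) = lam a (antipodeV (antipode H a (hitr y nu)) * x),
      forall (nuV : 'Hom(H 1%g, k^o)) (gV : H a),
        convolution_inverse nu nuV -> mul_inverse (g a) gV ->
        lam a (x * y) =
        lam a (y * antipodeV (antipode H a (hitl nuV (gV * x * g a)))) &
      lam a^-1%g (antipode H a x) = lam a (g a * x)].
Proof.
move=> lamI [gG /(_ lam lamI) lamg] [nuA Lnu] a x y.
(* If [lam 1] vanishes then so does every [lam a], and all three identities read [0 = 0]. *)
have [lam0|lam_neq0] := eqVneq (lam 1%g) 0.
  by split=> [|nuV gV _ _|]; rewrite !(integral_eq0 lamI lam0).
have [L [Lint lamL]] := left_integral_exists lamI lam_neq0.
have {}Lnu := Lnu L Lint.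
have eab := esym (mulgV a); have eSb := esym (invgK a).
have SaE (z : H a) : antipode H a z = anti erefl z by [].
have SbE (z : H a^-1%g) : antipodeV z = anti eSb z.
  by rewrite /anti (eq_irrelevance (esym eSb) (invgK a)).
rewrite !SaE; split=> [|nuV gV [_ nuK] [gK _]|].
- by rewrite SbE (integral_nakayama lamI Lint lamL eab erefl eSb _ _ Lnu).
(* Inserting [g a * gV] produces the leading [g a] of [integral_grouplike_nakayama], which is then
   used for the conjugate [gV * x * g a] and for [gV * y]. *)
- have lamK z : lam a z = lam a (g a * (gV * z)) by rewrite mulrA gK mul1r.
  rewrite SaE SbE lamK [RHS]lamK.
  have -> : gV * (x * y) = gV * x * g a * (gV * y).
    by rewrite [RHS]mulrA -(mulrA (gV * x)) gK mulr1 mulrA.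
  have nakayama :=
    integral_grouplike_nakayama lamI Lint lamL nuA Lnu gG lamg eab erefl eSb.
  by rewrite (nakayama _ _ _ nuK) !mulrA.
exact: (integral_anti lamI Lint lamL nuA Lnu gG lamg eab erefl eSb x).
Qed.
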